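(* There is an absolute constant $\eta > 0$ such that the following holds. Let $m \geq 3$ and $n$ be positive integers, let $Q_1, \ldots, Q_m$ be $n \times n$ real symmetric matrices such that $$\mathrm{trace}\, Q_i = 0 \quad \text{for} \quad i = 1, \ldots, m,$$ and let $q_i: \mathbb{R}^n \longrightarrow \mathbb{R}$, $q_i(x) = \langle Q_i x, x \rangle$ for $i = 1, \ldots, m$, be the corresponding quadratic forms. Suppose that $$\left\| \sum_{i=1}^m A_i^2 \right\|_{\mathrm{op}} \leq \frac{\eta}{m}$$ for some (equivalently, for any) orthonormal basis $A_1, \ldots, A_m$ of the subspace $\mathrm{span}(Q_1, \ldots, Q_m)$. Then the system of equations $$q_i(x) = 0 \quad \text{for} \quad i = 1, \ldots, m$$ has a solution $x \in \mathbb{R}^n$, $x \neq 0$.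
   Context: $\langle x, y\rangle = \sum_{i=1}^n \xi_i \eta_i$ is the standard scalar product of $x=(\xi_1,\ldots,\xi_n)$ and $y=(\eta_1,\ldots,\eta_n)$ in $\mathbb{R}^n$. The space of $n \times n$ real symmetric matrices is a Euclidean space with inner product $\langle X, Y \rangle = \mathrm{trace}(XY)$, and ''orthonormal basis'' refers to this inner product: $\mathrm{trace}(A_i A_j) = 1$ if $i = j$ and $0$ if $i \neq j$. The orthonormal basis $A_1,\ldots,A_m$ has exactly $m$ elements. The matrix $A_1^2+\ldots+A_m^2$ does not depend on the choice of an orthonormal basis of the subspace. For a real symmetric matrix $Q$, $\|Q\|_{\mathrm{op}}$ is the operator norm, that is, the largest absolute value of an eigenvalue of $Q$. ''Absolute constant'' means that $\eta$ does not depend on $m$, $n$ or the matrices. *)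

(* Defs.v *)
From mathcomp Require Import all_boot all_order all_algebra.
From mathcomp Require Import classical_sets reals.

Set Implicit Arguments.
Unset Strict Implicit.
Unset Printing Implicit Defensive.

Import Order.TTheory GRing.Theory Num.Theory.
Local Open Scope ring_scope.

Definition dotp (R : realType) (n : nat) (x y : 'cV[R]_n) : R :=
  \sum_(i < n) x i 0 * y i 0.

Definition qform (R : realType) (n : nat) (Q : 'M[R]_n) (x : 'cV[R]_n) : R :=
  dotp (Q *m x) x.

(* Only meant for real symmetric S with 0 < n: the set of real eigenvalues is
   then finite and nonempty, so that the supremum is a maximum. *)
Definition opnorm (R : realType) (n : nat) (S : 'M[R]_n) : R :=
  sup [set r : R | exists2 a : R, eigenvalue S a & r = `|a|]%classic.

(* Both families are indexed by 'I_m, hence an orthonormal basis in this sense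
   exists only if span(Q_1, ..., Q_m) has dimension m. *)
Definition orthonormal_basis_of_span (R : realType) (m n : nat)
    (Q A : 'I_m -> 'M[R]_n) : Prop :=
  basis_of <<codom Q>>%VS (codom A) /\
  forall i j : 'I_m, \tr (A i *m A j) = (i == j)%:R.

Definition sum_squares (R : realType) (m n : nat) (A : 'I_m -> 'M[R]_n) :
    'M[R]_n :=
  \sum_(i < m) A i *m A i.

(* Main.v *)
(* Let A_1, ..., A_m be an orthonormal basis of the span, q_i the quadratic form
   of A_i, and let x minimize q_1^2 + ... + q_m^2 on the unit sphere.  Suppose
   that the minimum s is positive and put B = \sum_i q_i(x) A_i.  If v is
   orthogonal to x and to all A_i x, then
     \sum_i q_i(x + t v)^2 = s + 2 t^2 <B v, v> + O(t^4)
   is at least s |x + t v|^4 >= s, so B is positive semidefinite on a subspace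
   of codimension at most m + 1.  Moreover tr B = 0, tr B^2 = s, and by
   Cauchy-Schwarz |B v|^2 <= c^2 |v|^2 with c^2 = s eta / m.  Let P be the
   orthogonal projection onto the span of x and the A_i x.  The part of B off
   the semidefinite block contributes at most 2 c^2 tr P to tr B^2; the
   semidefinite block T contributes tr T^2 <= c tr T, and
   tr T = - tr (P B P) <= c tr P because tr B = 0.
   Hence s <= 3 c^2 (m + 1) <= 4 eta s, which is absurd for eta = 1/5. *)
Require Import Defs.
From mathcomp Require Import all_boot all_order all_algebra.
From mathcomp Require Import classical_sets reals.
From mathcomp Require Import boolp topology normedtype derive.
From mathcomp Require Import ring lra.

Set Implicit Arguments.
Unset Strict Implicit.
Unset Printing Implicit Defensive.

Import Order.TTheory GRing.Theory Num.Theory.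
Import numFieldNormedType.Exports.
Local Open Scope ring_scope.

(** * Scalar products and quadratic forms *)

Section Dotp.
Context {R : realType} {n : nat}.
Implicit Types (x y z u v : 'cV[R]_n) (X Y S P : 'M[R]_n).

Lemma dotpE x y : dotp x y = (x^T *m y) 0 0.
Proof. by rewrite mxE; apply: eq_bigr => i _; rewrite mxE. Qed.

Lemma dotpC x y : dotp x y = dotp y x.
Proof. by apply: eq_bigr => i _; rewrite mulrC. Qed.

Lemma dotpDl x y z : dotp (x + y) z = dotp x z + dotp y z.
Proof. by rewrite !dotpE linearD mulmxDl mxE. Qed.

Lemma dotpDr x y z : dotp z (x + y) = dotp z x + dotp z y.
Proof. by rewrite !dotpE mulmxDr mxE. Qed.

Lemma dotpZl a x y : dotp (a *: x) y = a * dotp x y.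
Proof. by rewrite !dotpE linearZ -scalemxAl mxE. Qed.

Lemma dotpZr a x y : dotp x (a *: y) = a * dotp x y.
Proof. by rewrite !dotpE -scalemxAr mxE. Qed.

Lemma dotp0l x : dotp 0 x = 0.
Proof. by rewrite dotpE linear0 mul0mx mxE. Qed.

Lemma dotp_suml m (F : 'I_m -> 'cV[R]_n) y :
  dotp (\sum_i F i) y = \sum_i dotp (F i) y.
Proof.
rewrite dotpE linear_sum /= mulmx_suml summxE.
by apply: eq_bigr => i _; rewrite dotpE.
Qed.

Lemma dotp_mulmxl X x y : dotp (X *m x) y = dotp x (X^T *m y).
Proof. by rewrite !dotpE trmx_mul mulmxA. Qed.

Lemma dotp_ge0 x : 0 <= dotp x x.
Proof. by apply: sumr_ge0 => i _; rewrite -expr2 sqr_ge0. Qed.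

Lemma dotp_eq0 x : (dotp x x == 0) = (x == 0).
Proof.
rewrite psumr_eq0 => [|i _]; last by rewrite -expr2 sqr_ge0.
apply/allP/eqP => [x0|-> i _]; last by rewrite mxE mul0r eqxx.
apply/matrixP => i j; rewrite ord1 mxE.
by have := x0 i (mem_index_enum i); rewrite -expr2 sqrf_eq0 => /eqP.
Qed.

Lemma dotp_gt0 x : (0 < dotp x x) = (x != 0).
Proof. by rewrite lt_def dotp_ge0 andbT dotp_eq0. Qed.

Lemma qformDl X Y x : qform (X + Y) x = qform X x + qform Y x.
Proof. by rewrite /qform mulmxDl dotpDl. Qed.

Lemma qformZl a X x : qform (a *: X) x = a * qform X x.
Proof. by rewrite /qform -scalemxAl dotpZl. Qed.

Lemma qformNl X x : qform (- X) x = - qform X x.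
Proof. by rewrite -scaleN1r qformZl mulN1r. Qed.

Lemma qform_suml m (F : 'I_m -> 'M[R]_n) x :
  qform (\sum_i F i) x = \sum_i qform (F i) x.
Proof. by rewrite /qform mulmx_suml dotp_suml. Qed.

Lemma qform_scalar a x : qform a%:M x = a * dotp x x.
Proof. by rewrite /qform mul_scalar_mx dotpZl. Qed.

Lemma qformZ X a x : qform X (a *: x) = a ^+ 2 * qform X x.
Proof. by rewrite /qform -scalemxAr dotpZl dotpZr mulrA expr2. Qed.

Lemma qformD X x y : X^T = X ->
  qform X (x + y) = qform X x + dotp (X *m x) y *+ 2 + qform X y.
Proof.
move=> symX; rewrite /qform mulmxDr !dotpDl !dotpDr.
by rewrite (dotp_mulmxl X y) symX [dotp y (X *m x)]dotpC; ring.
Qed.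

Lemma qform_mul3 X Y x : X^T = X -> qform (X *m Y *m X) x = qform Y (X *m x).
Proof.
by move=> symX; rewrite /qform -!mulmxA (dotp_mulmxl X) symX.
Qed.

Lemma qform_sqr X x : X^T = X -> qform (X *m X) x = dotp (X *m x) (X *m x).
Proof. by move=> symX; rewrite /qform -mulmxA dotp_mulmxl symX. Qed.

Lemma qform_delta X i : qform X (delta_mx i 0) = X i i.
Proof.
rewrite /qform -colE /dotp (bigD1 i) //= big1 => [|j /negPf jDi].
  by rewrite !mxE !eqxx mulr1 addr0.
by rewrite !mxE jDi mulr0.
Qed.

Lemma ler_mxtrace X Y : (forall v, qform X v <= qform Y v) -> \tr X <= \tr Y.
Proof. by move=> leXY; apply: ler_sum => i _; rewrite -!qform_delta. Qed.

End Dotp.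

(** * Positive semidefinite forms, projections and the trace estimate *)

Lemma discriminant_le (R : realFieldType) (a b c : R) : 0 <= c ->
  (forall t, 0 <= a + t * b *+ 2 + t ^+ 2 * c) -> b ^+ 2 <= a * c.
Proof.
rewrite le_eqVlt => /orP[/eqP<-|c_gt0] pos; last first.
  (* The vertex of the parabola, where its value is [(a * c - b ^+ 2) / c]. *)
  have := pos (- b / c).
  suff -> : a + (- b / c) * b *+ 2 + (- b / c) ^+ 2 * c = (a * c - b ^+ 2) / c.
    by rewrite pmulr_lge0 ?invr_gt0 // subr_ge0.
  by field; rewrite gt_eqF.
case: (eqVneq b 0) => [->|b0]; first by rewrite mulr0 expr0n.
(* With [c = 0] the function is affine; this [t] gives it the value -1. *)
have := pos (- (a + 1) / (b *+ 2)).
suff -> : a + - (a + 1) / (b *+ 2) * b *+ 2 +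
    (- (a + 1) / (b *+ 2)) ^+ 2 * 0 = -1 by rewrite lerNr oppr0 ler10.
by field.
Qed.

Section Psd.
Context {R : realType} {n : nat}.
Implicit Types (x y z u v : 'cV[R]_n) (X Y S P : 'M[R]_n).

Lemma psd_cauchy S u v : S^T = S -> (forall x, 0 <= qform S x) ->
  dotp (S *m u) v ^+ 2 <= qform S u * qform S v.
Proof.
move=> symS psdS; apply: discriminant_le => // t.
have := psdS (u + t *: v).
by rewrite qformD // dotpZr qformZ.
Qed.

Lemma dotp_cauchy u v : dotp u v ^+ 2 <= dotp u u * dotp v v.
Proof.
have := @psd_cauchy 1%:M u v.
rewrite !qform_scalar !mul1r mul1mx; apply; first exact: trmx1.
by move=> x; rewrite qform_scalar mul1r dotp_ge0.
Qed.

(** Cauchy-Schwarz for the form of [S], applied to [x] and [S *m x], bounds |S x|^4 by 0. *)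
Lemma psd_ker S x : S^T = S -> (forall x, 0 <= qform S x) ->
  qform S x = 0 -> S *m x = 0.
Proof.
move=> symS psdS Sx0; apply/eqP; rewrite -dotp_eq0 -sqrf_eq0 eq_le sqr_ge0.
by have := psd_cauchy x (S *m x) symS psdS; rewrite Sx0 mul0r => ->.
Qed.

(* [|S x|^4 <= <S x, x> <S (S x), S x> <= <S x, x> c |S x|^2] *)
Lemma psd_sqr_le S c x : S^T = S -> (forall x, 0 <= qform S x) ->
  (forall x, qform S x <= c * dotp x x) -> qform (S *m S) x <= c * qform S x.
Proof.
move=> symS psdS leS; rewrite qform_sqr //.
have := psd_cauchy x (S *m x) symS psdS.
have := leS (S *m x); have := psdS x.
case: (eqVneq (S *m x) 0) => [Sx0|].
  by rewrite [qform S x]/qform Sx0 !dotp0l mulr0.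
rewrite -dotp_gt0.
move: (dotp (S *m x) (S *m x)) (qform S x) (qform S (S *m x)) => d q r.
move=> d_gt0 q_ge0 le_r le_d; rewrite -(ler_pM2r d_gt0) -expr2.
apply: le_trans le_d _; rewrite (_ : c * q * d = q * (c * d)); last by ring.
by rewrite ler_wpM2l.
Qed.

Lemma qform_norm_le S c x : 0 <= c ->
  (forall x, dotp (S *m x) (S *m x) <= c ^+ 2 * dotp x x) ->
  `|qform S x| <= c * dotp x x.
Proof.
move=> c_ge0 leS; rewrite -ler_sqr ?nnegrE ?mulr_ge0 ?dotp_ge0 //.
rewrite real_normK ?num_real //; apply: le_trans (dotp_cauchy _ _) _.
by rewrite exprMn expr2 [in leRHS]expr2 mulrA ler_wpM2r ?dotp_ge0.
Qed.

(** Gram-Schmidt: each new vector adds a projection of rank at most one. The trace stands in for the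
    dimension of the range; it is only bounded because the vectors may be dependent. *)
Lemma orthogonal_projection (s : seq 'cV[R]_n) :
  exists P, [/\ P^T = P, P *m P = P, \tr P <= (size s)%:R
    & forall x, x \in s -> P *m x = x].
Proof.
elim: s => [|c s [P [symP idemP trP fixP]]].
  by exists 0; rewrite trmx0 mul0mx mxtrace0.
have [Pc|] := eqVneq (P *m c) c.
  exists P; split => //; first by rewrite (le_trans trP) // ler_nat.
  by move=> x; rewrite inE => /predU1P[->|/fixP].
rewrite eq_sym -subr_eq0; set d := c - P *m c => d0.
have Pd : P *m d = 0 by rewrite mulmxBr mulmxA idemP subrr.
have dP : d^T *m P = 0 by rewrite -[P]symP -trmx_mul Pd trmx0.
have dd : d^T *m d = (dotp d d)%:M by rewrite [LHS]mx11_scalar -dotpE.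
have e0 : dotp d d != 0 by rewrite dotp_eq0.
(* The orthogonal projection onto the line of [d], the component of [c] orthogonal to the range of
   [P]. *)
pose D := (dotp d d)^-1 *: (d *m d^T).
exists (P + D); split.
- by rewrite linearD linearZ /= trmx_mul trmxK symP.
- rewrite mulmxDl !mulmxDr idemP /D -!scalemxAl -!scalemxAr.
  rewrite mulmxA Pd mul0mx scaler0 addr0 -mulmxA dP mulmx0 scaler0 add0r.
  rewrite mulmxA -(mulmxA d) dd mul_mx_scalar -scalemxAl.
  by rewrite [(dotp d d)^-1 *: (dotp d d *: _)]scalerA mulVf // scale1r.
- rewrite mxtraceD mxtraceZ mxtrace_mulC dd mxtrace_scalar mulr1n mulVf //.
  by rewrite /= -natr1 lerD2r.
- have De x : D *m x = (dotp d x / dotp d d) *: d.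
    rewrite -scalemxAl -mulmxA [d^T *m x]mx11_scalar -dotpE mul_mx_scalar.
    by rewrite scalerA mulrC.
  move=> x; rewrite inE => /predU1P[->|xs]; rewrite mulmxDl De.
    have -> : dotp d c = dotp d d.
      have -> : dotp d c = dotp d (d + P *m c) by rewrite subrK.
      rewrite dotpDr [dotp d (P *m c)]dotpC dotp_mulmxl symP Pd dotpC.
      by rewrite dotp0l addr0.
    by rewrite divff // scale1r addrC subrK.
  rewrite (fixP _ xs) -(fixP _ xs) dotpC dotp_mulmxl symP Pd dotpC dotp0l.
  by rewrite mul0r scale0r addr0 fixP.
Qed.

(** With [N = 1 - P], the trace of S^2 splits into those of P S^2 P, P S N S P and T^2, where T = N
    S N; each is at most c^2 tr P. *)
Lemma trace_sqr_le S P c : 0 <= c -> S^T = S -> \tr S = 0 ->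
  P^T = P -> P *m P = P ->
  (forall v, dotp (S *m v) (S *m v) <= c ^+ 2 * dotp v v) ->
  (forall v, P *m v = 0 -> 0 <= qform S v) ->
  \tr (S *m S) <= c ^+ 2 * \tr P *+ 3.
Proof.
move=> c_ge0 symS trS symP idemP leS psdS.
pose N := 1%:M - P.
have symN : N^T = N by rewrite linearB /= trmx1 symP.
have idemN : N *m N = N.
  by rewrite mulmxBl !mulmxBr mul1mx !mulmx1 mul1mx idemP subrr subr0.
have PN v : P *m (N *m v) = 0.
  by rewrite mulmxA mulmxBr mulmx1 idemP subrr mul0mx.
have qformP v : qform P v = dotp (P *m v) (P *m v).
  by rewrite -qform_sqr // idemP.
have qformN v : qform N v = dotp (N *m v) (N *m v).
  by rewrite -qform_sqr // idemN.
have leN v : dotp (N *m v) (N *m v) <= dotp v v.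
  rewrite -qformN /N qformDl qformNl qform_scalar mul1r gerBl qformP.
  exact: dotp_ge0.
have tr_idem Q X : Q *m Q = Q -> \tr (X *m Q) = \tr (Q *m X *m Q).
  by move=> idemQ; rewrite -mulmxA [RHS]mxtrace_mulC -mulmxA idemQ.
have trD X : \tr X = \tr (P *m X *m P) + \tr (N *m X *m N).
  rewrite -!tr_idem // -mxtraceD -mulmxDr /N addrC subrK mulmx1 //.
have leP : \tr (P *m (S *m S) *m P) <= c ^+ 2 * \tr P.
  rewrite -mxtraceZ; apply: ler_mxtrace => v.
  by rewrite qform_mul3 // qform_sqr // qformZl qformP leS.
have lePN : \tr (P *m (S *m N *m S) *m P) <= c ^+ 2 * \tr P.
  apply: le_trans leP; apply: ler_mxtrace => v.
  by rewrite !qform_mul3 // qform_sqr // qformN leN.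
pose T := N *m S *m N.
have symT : T^T = T by rewrite !trmx_mul symN symS mulmxA.
have psdT v : 0 <= qform T v by rewrite qform_mul3 // psdS.
have leT v : qform T v <= c * dotp v v.
  rewrite qform_mul3 // (le_trans (ler_norm _)) //.
  by rewrite (le_trans (qform_norm_le _ c_ge0 leS)) // ler_wpM2l.
have trTT : \tr (T *m T) <= c * \tr T.
  rewrite -mxtraceZ; apply: ler_mxtrace => v; rewrite qformZl.
  exact: psd_sqr_le.
have trT : \tr T <= c * \tr P.
  have := trD S; rewrite trS -/T => /esym/eqP; rewrite addrC addr_eq0 => /eqP->.
  rewrite -linearN -mxtraceZ; apply: ler_mxtrace => v.
  rewrite qformNl qform_mul3 // qformZl qformP.
  by rewrite (le_trans _ (qform_norm_le _ c_ge0 leS)) // -normrN ler_norm.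
(* Both sides equal tr (S N S): the left one by cyclicity of the trace, the right one by [trD]. *)
have SS : \tr (N *m (S *m S) *m N) =
    \tr (P *m (S *m N *m S) *m P) + \tr (T *m T).
  have -> : T *m T = N *m (S *m N *m S) *m N.
    by rewrite /T !mulmxA -(mulmxA (N *m S) N N) idemN.
  by rewrite -trD -tr_idem // -mulmxA mxtrace_mulC.
rewrite (trD (S *m S)) SS mulrSr mulr2n -addrA lerD // lerD //.
by rewrite (le_trans trTT) // expr2 -mulrA ler_wpM2l.
Qed.

End Psd.

(** * Minima on the unit sphere, Rayleigh quotients and the operator norm *)

Section Compactness.
Context {R : realType} {n : nat}.
Hypothesis n_gt0 : (0 < n)%N.
Implicit Types (x y : 'cV[R]_n) (S : 'M[R]_n).

(** Row vectors are used because [rV_compact] and [EVT_min_rV] concern them. *)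
Lemma qform_continuous S : continuous (fun u : 'rV[R]_n => qform S u^T).
Proof.
have coordC i : continuous (fun u : 'rV[R]_n => u^T i 0).
  move=> u; rewrite (_ : (fun u => _) = fun u : 'rV[R]_n => u 0 i).
    exact: coord_continuous.
  by apply/funext => v; rewrite mxE.
apply: continuous_big => [|i _]; first exact: add_continuous.
move=> u; apply: continuousM; last exact: coordC.
rewrite (_ : (fun u => _) = fun u : 'rV[R]_n => \sum_j S i j * u^T j 0).
  apply: (continuous_big (P := xpredT)) => [|j _ v].
    exact: add_continuous.
  apply: continuousM; [exact: cst_continuous|exact: coordC].
by apply/funext => v; rewrite mxE.
Qed.

(** The sphere is a closed subset of the compact box [-1, 1]^n, and is nonempty since n > 0. *)
Lemma sphere_min (f : 'cV[R]_n -> R) :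
  continuous (fun u : 'rV[R]_n => f u^T) ->
  exists x, dotp x x = 1 /\ forall y, dotp y y = 1 -> f x <= f y.
Proof.
move=> fC; pose A := [set u : 'rV[R]_n | dotp u^T u^T = 1]%classic.
have A0 : (A !=set0)%classic.
  exists (delta_mx (Ordinal n_gt0) 0)^T; rewrite /A /= trmxK.
  by rewrite -[LHS]mul1r -qform_scalar qform_delta mxE eqxx.
have Acompact : compact A.
  have box := @rV_compact R n (fun=> `[-1, 1]%classic)
    (fun=> @segment_compact _ _ _).
  apply: subclosed_compact box _.
    have -> : A = ((fun u : 'rV[R]_n => qform 1%:M u^T) @^-1` [set 1])%classic.
      by apply/seteqP; split => u; rewrite /A /= qform_scalar mul1r.
    apply: preimage_closed; last exact: closed_eq.
    by move=> u _; exact: qform_continuous.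
  move=> u; rewrite /A /= => u1 i; rewrite in_itv /= -ler_norml.
  rewrite -(@ler_pXn2r _ 2) ?nnegrE // expr1n -u1 real_normK ?num_real //.
  rewrite /dotp (bigD1 i) //= mxE -expr2 lerDl.
  by apply: sumr_ge0 => j _; rewrite -expr2 sqr_ge0.
have [u /set_mem uA umin] :=
  EVT_min_rV A0 Acompact (continuous_subspaceT fC).
exists u^T; split => // y y1; rewrite -[y]trmxK; apply: umin.
by rewrite inE /A /= trmxK.
Qed.

Lemma homogeneous_min (d : nat) (f : 'cV[R]_n -> R) : (0 < d)%N ->
  continuous (fun u : 'rV[R]_n => f u^T) ->
  (forall a y, f (a *: y) = a ^+ (2 * d) * f y) ->
  exists x, dotp x x = 1 /\ forall y, f x * dotp y y ^+ d <= f y.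
Proof.
move=> d_gt0 fC fZ; have [x [x1 xmin]] := sphere_min fC.
exists x; split => // y; have [->|y0] := eqVneq y 0.
  (* At 0, homogeneity with factor 0 gives [f 0 = 0]. *)
  rewrite dotp0l expr0n eqn0Ngt d_gt0 mulr0.
  have := fZ 0 0; rewrite scale0r expr0n muln_eq0 /= eqn0Ngt d_gt0 mul0r.
  by move=> ->.
have e_gt0 : 0 < dotp y y by rewrite dotp_gt0.
pose a := Num.sqrt (dotp y y).
have a2 : a ^+ 2 = dotp y y by rewrite sqr_sqrtr // ltW.
have a0 : a != 0 by rewrite gt_eqF // sqrtr_gt0.
rewrite -[y in leRHS](scalerKV a0) fZ exprM a2 mulrC ler_pM2l ?exprn_gt0 //.
apply: xmin; rewrite dotpZl dotpZr mulrA -a2.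
by field.
Qed.

(** At a maximizer [x] on the sphere with value [a], the semidefinite form of [a%:M - S] vanishes,
    so [psd_ker] makes [x] an eigenvector. *)
Lemma rayleigh_max S : S^T = S ->
  exists2 a, eigenvalue S a & forall y, qform S y <= a * dotp y y.
Proof.
move=> symS.
have [||a y|x [x1 xmin]] := @homogeneous_min 1 (qform (- S)) => //.
- exact: qform_continuous.
- exact: qformZ.
have {}xmin y : qform S y <= qform S x * dotp y y.
  by have := xmin y; rewrite !qformNl mulNr lerN2.
exists (qform S x) => //; set a := qform S x.
have : (a%:M - S) *m x = 0.
  apply: psd_ker.
  - by rewrite linearB /= tr_scalar_mx symS.
  - by move=> y; rewrite qformDl qformNl qform_scalar subr_ge0.
  - by rewrite qformDl qformNl qform_scalar x1 mulr1 subrr.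
move/eqP; rewrite mulmxBl mul_scalar_mx subr_eq0 => /eqP Sx.
(* [eigenvalue] refers to row eigenvectors, hence the transpose and the symmetry of [S]. *)
apply/eigenvalueP; exists x^T; first by rewrite -{1}symS -trmx_mul -Sx linearZ.
by rewrite trmx_eq0 -dotp_eq0 x1 oner_eq0.
Qed.

Lemma qform_le_opnorm S y : S^T = S -> qform S y <= opnorm S * dotp y y.
Proof.
move=> symS; have [a Sa le_a] := rayleigh_max symS.
have [|b _ le_b] := @rayleigh_max (- S); first by rewrite linearN /= symS.
apply: le_trans (le_a y) _; apply: ler_wpM2r; first exact: dotp_ge0.
apply: le_trans (ler_norm _) _; apply: ub_le_sup; last by exists a.
(* The eigenvalues must be shown bounded for [sup] to be an upper bound: [a] bounds every eigenvalue
   r, and [b], the maximum for [- S], bounds -r. *)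
exists (Num.max a b) => _ [r /eigenvalueP[v vS v0] ->].
have Sv : qform S v^T = r * dotp v^T v^T.
  by rewrite /qform -[S]symS -trmx_mul vS linearZ dotpZl.
have v_gt0 : 0 < dotp v^T v^T by rewrite dotp_gt0 trmx_eq0.
rewrite ler_norml lerNl !le_max -(ler_pM2r v_gt0 (- r) b).
by rewrite -(ler_pM2r v_gt0 r a) mulNr -Sv le_a -qformNl le_b orbT.
Qed.

End Compactness.

(** * Orthonormal bases for the trace inner product *)

Section OrthonormalBasis.
Context {R : realType} {m n : nat}.
Implicit Types (Q A B : 'I_m -> 'M[R]_n).

Lemma orthonormal_trace A (a : 'I_m -> R) i :
  (forall i j : 'I_m, \tr (A i *m A j) = (i == j)%:R) ->
  \tr (A i *m \sum_j a j *: A j) = a i.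
Proof.
move=> orthoA; rewrite mulmx_sumr linear_sum /= (bigD1 i) //= big1 => [|k kj].
  by rewrite -scalemxAr mxtraceZ orthoA eqxx mulr1 addr0.
by rewrite -scalemxAr mxtraceZ orthoA eq_sym (negPf kj) mulr0.
Qed.

Lemma span_comb Q X : X \in <<codom Q>>%VS ->
  exists a : 'I_m -> R, X = \sum_j a j *: Q j.
Proof.
rewrite span_def big_image /= => /memv_sumP[F FQ ->].
have /fin_all_exists[a aE] j : exists a, F j = a *: Q j.
  by have /vlineP[a ->] := FQ j isT; exists a.
by exists a; apply: eq_bigr => j _.
Qed.

Lemma span_expand Q A X : orthonormal_basis_of_span Q A ->
  X \in <<codom Q>>%VS -> X = \sum_j \tr (A j *m X) *: A j.
Proof.
move=> [/andP[/eqP <- _] orthoA] /span_comb[a ->].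
by apply: eq_bigr => j _; rewrite orthonormal_trace.
Qed.

Lemma basis_mem_span Q A i : orthonormal_basis_of_span Q A ->
  A i \in <<codom Q>>%VS.
Proof.
by move=> [/andP[/eqP <- _] _]; rewrite memv_span // codom_f.
Qed.

(** Expanding one factor of each square turns both sums into the double sum of tr(A_i B_j) A_i B_j,
    since the same coefficients expand A in B and B in A. *)
Lemma sum_squares_basis Q A B : orthonormal_basis_of_span Q A ->
  orthonormal_basis_of_span Q B -> sum_squares A = sum_squares B.
Proof.
move=> basA basB.
pose u i j := \tr (A i *m B j).
have AE i : A i = \sum_j u i j *: B j.
  rewrite [LHS](span_expand basB (basis_mem_span i basA)).
  by apply: eq_bigr => j _; rewrite mxtrace_mulC.
have BE j : B j = \sum_i u i j *: A i.
  exact: (span_expand basA (basis_mem_span j basB)).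
rewrite /sum_squares.
transitivity (\sum_i \sum_j u i j *: (A i *m B j)).
  apply: eq_bigr => i _; rewrite {2}AE mulmx_sumr.
  by apply: eq_bigr => j _; rewrite scalemxAr.
rewrite exchange_big /=; apply: eq_bigr => j _; rewrite {2}BE mulmx_suml.
by apply: eq_bigr => i _; rewrite scalemxAl.
Qed.

End OrthonormalBasis.

(** * The sum of squared forms and its minimizer *)

Section SumOfSquares.
Context {R : realType} {m n : nat}.
Variable A : 'I_m -> 'M[R]_n.
Hypothesis symA : forall i, (A i)^T = A i.
Implicit Types (x v : 'cV[R]_n) (a : 'I_m -> R).

Lemma sum_squares_sym : (sum_squares A)^T = sum_squares A.
Proof.
by rewrite linear_sum /=; apply: eq_bigr => i _; rewrite trmx_mul symA.
Qed.

(** Cauchy-Schwarz in R^m, applied to each coordinate [k] of the vector and summed over [k]. *)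
Lemma comb_norm_le a v :
  dotp ((\sum_i a i *: A i) *m v) ((\sum_i a i *: A i) *m v) <=
  (\sum_i a i ^+ 2) * qform (sum_squares A) v.
Proof.
rewrite qform_suml mulmx_suml.
have -> : \sum_i qform (A i *m A i) v =
    \sum_k \sum_i (A i *m v) k 0 ^+ 2.
  by rewrite [RHS]exchange_big /=; apply: eq_bigr => i _; rewrite qform_sqr.
rewrite mulr_sumr; apply: ler_sum => k _.
pose b := \col_i (A i *m v) k 0.
have -> : \sum_i a i ^+ 2 = dotp (\col_i a i) (\col_i a i).
  by apply: eq_bigr => i _; rewrite !mxE expr2.
have -> : \sum_i (A i *m v) k 0 ^+ 2 = dotp b b.
  by apply: eq_bigr => i _; rewrite !mxE expr2.
have -> : (\sum_i a i *: A i *m v) k 0 = dotp (\col_i a i) b.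
  rewrite summxE; apply: eq_bigr => i _.
  by rewrite -scalemxAl [LHS]mxE !mxE.
by rewrite -expr2 dotp_cauchy.
Qed.

Lemma trace_comb_sqr a : (forall i j : 'I_m, \tr (A i *m A j) = (i == j)%:R) ->
  \tr ((\sum_i a i *: A i) *m \sum_i a i *: A i) = \sum_i a i ^+ 2.
Proof.
move=> orthoA; rewrite mulmx_suml linear_sum /=; apply: eq_bigr => i _.
by rewrite -scalemxAl /= mxtraceZ orthonormal_trace.
Qed.

Lemma sum_sqr_qform_min : (0 < n)%N ->
  exists x, dotp x x = 1 /\ forall y,
    (\sum_i qform (A i) x ^+ 2) * dotp y y ^+ 2 <= \sum_i qform (A i) y ^+ 2.
Proof.
move=> n_gt0; apply: (@homogeneous_min _ _ n_gt0 2) => [||b y] //.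
  apply: continuous_big => [|i _ u]; first exact: add_continuous.
  apply: (@continuousM _ _ (fun u => qform (A i) u^T));
    exact: qform_continuous.
rewrite mulr_sumr; apply: eq_bigr => i _.
by rewrite qformZ exprMn -exprM.
Qed.

Lemma second_order_condition x v : dotp x x = 1 ->
  (forall y,
    (\sum_i qform (A i) x ^+ 2) * dotp y y ^+ 2 <= \sum_i qform (A i) y ^+ 2) ->
  dotp x v = 0 -> (forall i, dotp (A i *m x) v = 0) ->
  0 <= qform (\sum_i qform (A i) x *: A i) v.
Proof.
move=> x1 xmin xv Axv; rewrite qform_suml.
under eq_bigr do rewrite qformZl.
set s := \sum_i qform (A i) x ^+ 2 in xmin; set b := \sum_i _.
pose c := \sum_i qform (A i) v ^+ 2.
have s_ge0 : 0 <= s by apply: sumr_ge0 => i _; rewrite sqr_ge0.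
have c_ge0 : 0 <= c by apply: sumr_ge0 => i _; rewrite sqr_ge0.
(* Orthogonality of [v] to all A_i x removes the terms linear in [t] from each form. *)
have expand t : \sum_i qform (A i) (x + t *: v) ^+ 2 =
    s + t ^+ 2 * b *+ 2 + (t ^+ 2) ^+ 2 * c.
  rewrite /s /b /c -mulrnAr -sumrMnl !mulr_sumr -!big_split /=.
  apply: eq_bigr => i _.
  by rewrite qformD // dotpZr Axv mulr0 mul0rn addr0 qformZ; ring.
(* As [v] is orthogonal to the unit vector [x], |x + t v| >= 1, so the minimum [s] cancels. *)
have pos t : 0 <= t ^+ 2 * b *+ 2 + (t ^+ 2) ^+ 2 * c.
  have := xmin (x + t *: v); rewrite expand -addrA -lerBlDl; apply: le_trans.
  rewrite -{2}[s]mulr1 -mulrBr mulr_ge0 // subr_ge0.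
  have -> : dotp (x + t *: v) (x + t *: v) = 1 + t ^+ 2 * dotp v v.
    rewrite dotpDl !dotpDr !dotpZl !dotpZr x1 xv dotpC xv.
    by ring.
  rewrite -[leLHS](expr1n _ 2) lerXn2r ?nnegrE ?addr_ge0 ?lerDl //;
    by rewrite mulr_ge0 ?sqr_ge0 ?dotp_ge0.
rewrite leNgt; apply/negP => b_lt0.
have c1 : 0 < c + 1 by rewrite ltr_wpDl.
(* This value of t^2 makes the expression in [pos] negative when [b < 0]; the 1 keeps the
   denominator positive if [c = 0]. *)
have tau_gt0 : 0 < - b / (c + 1) by rewrite divr_gt0 // oppr_gt0.
have := pos (Num.sqrt (- b / (c + 1))); rewrite (sqr_sqrtr (ltW tau_gt0)).
have -> : - b / (c + 1) * b *+ 2 + (- b / (c + 1)) ^+ 2 * c =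
    - b / (c + 1) * (b / (c + 1) * (c + 2)).
  by field; rewrite gt_eqF.
rewrite pmulr_rge0 // pmulr_lge0 ?ltr_wpDl // pmulr_lge0 ?invr_gt0 //.
by rewrite leNgt b_lt0.
Qed.

Lemma common_zero : (3 <= m)%N -> (0 < n)%N ->
  (forall i, \tr (A i) = 0) ->
  (forall i j : 'I_m, \tr (A i *m A j) = (i == j)%:R) ->
  opnorm (sum_squares A) <= 5%:R^-1 / m%:R ->
  exists x, x != 0 /\ forall i, qform (A i) x = 0.
Proof.
move=> m_ge3 n_gt0 trA orthoA leA.
have [x [x1 xmin]] := sum_sqr_qform_min n_gt0.
exists x; split; first by rewrite -dotp_eq0 x1 oner_eq0.
set s := \sum_i qform (A i) x ^+ 2 in xmin.
have s_ge0 : 0 <= s by apply: sumr_ge0 => i _; rewrite sqr_ge0.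
have [s0 i|s_neq0] := eqVneq s 0.
  have /eqP := s0; rewrite psumr_eq0 => [|j _]; last by rewrite sqr_ge0.
  by move/allP/(_ i (mem_index_enum i)); rewrite sqrf_eq0 => /eqP.
have s_gt0 : 0 < s by rewrite lt_def s_neq0.
pose B := \sum_i qform (A i) x *: A i.
have m_gt0 : 0 < m%:R :> R by rewrite ltr0n (leq_trans _ m_ge3).
(* The norm bound for [B]: the coefficients of [B] have squares summing to [s], and [comb_norm_le]
   multiplies this by the bound on the operator norm. *)
pose c := Num.sqrt (s * (5%:R^-1 / m%:R)).
have c2 : c ^+ 2 = s * (5%:R^-1 / m%:R).
  by rewrite sqr_sqrtr // mulr_ge0 // divr_ge0 ?invr_ge0 ?ler0n.
have [P [symP idemP trP fixP]] :=
  orthogonal_projection (x :: [seq A i *m x | i : 'I_m]).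
have : \tr (B *m B) <= c ^+ 2 * \tr P *+ 3.
  apply: trace_sqr_le => //.
  - exact: sqrtr_ge0.
  - by rewrite linear_sum /=; apply: eq_bigr => i _; rewrite linearZ /= symA.
  - by rewrite linear_sum /= big1 // => i _; rewrite linearZ /= trA mulr0.
  - move=> v; apply: le_trans (comb_norm_le _ _) _; rewrite -/s c2 -mulrA.
    rewrite ler_pM2l //; apply: le_trans (qform_le_opnorm n_gt0 _ _) _.
      exact: sum_squares_sym.
    by rewrite ler_wpM2r // dotp_ge0.
  move=> v Pv; have orth y : P *m y = y -> dotp y v = 0.
    by move=> <-; rewrite dotp_mulmxl symP Pv dotpC dotp0l.
  apply: second_order_condition => // [|i]; apply/orth/fixP.
    by rewrite mem_head.
  by rewrite inE (fintype.image_f (fun i => A i *m x)) ?orbT.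
rewrite trace_comb_sqr // -/s c2 => le_s; exfalso.
move: trP; rewrite /= size_image card_ord => trP.
move: le_s; apply/negP; rewrite -ltNge.
apply: (@le_lt_trans _ _ (s * (5%:R^-1 / m%:R) * m.+1%:R *+ 3)).
  by rewrite lerMn2r ler_wpM2l // mulr_ge0 // divr_ge0 ?invr_ge0 ?ler0n.
(* It gives 3(m + 1) <= 4m < 5m, which makes the factor of [s] less than 1. *)
have le_m : 3%:R <= m%:R :> R by rewrite ler_nat.
have -> : s * (5%:R^-1 / m%:R) * m.+1%:R *+ 3 =
    s * ((3 * (m%:R + 1)) / (5 * m%:R)).
  by rewrite -natr1; field; rewrite gt_eqF.
by rewrite gtr_pMr // ltr_pdivrMr ?mulr_gt0 //; lra.
Qed.

End SumOfSquares.

(** * Transfer between the given matrices and an orthonormal basis of their span *)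

Theorem theorem1p2 (R : realType) :
  exists eta : R, 0 < eta /\
  forall (m n : nat) (Q : 'I_m -> 'M[R]_n),
    (3 <= m)%N -> (0 < n)%N ->
    (forall i : 'I_m, (Q i)^T = Q i) ->
    (forall i : 'I_m, \tr (Q i) = 0) ->
    (forall A B : 'I_m -> 'M[R]_n,
       orthonormal_basis_of_span Q A -> orthonormal_basis_of_span Q B ->
       (opnorm (sum_squares A) <= eta / m%:R <->
        opnorm (sum_squares B) <= eta / m%:R)) /\
    ((exists A : 'I_m -> 'M[R]_n,
        orthonormal_basis_of_span Q A /\
        opnorm (sum_squares A) <= eta / m%:R) ->
     exists x : 'cV[R]_n, x != 0 /\ forall i : 'I_m, qform (Q i) x = 0).
Proof.
exists 5%:R^-1; split=> [|m n Q m_ge3 n_gt0 symQ trQ]; first by rewrite invr_gt0.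
split=> [A B basA basB|[A [basA leA]]].
  by rewrite (sum_squares_basis basA basB).
(* Symmetry and zero trace are linear conditions, so they pass from the Q_j to the A_i. *)
have AQ i : exists a, A i = \sum_j a j *: Q j.
  by apply: span_comb; exact: basis_mem_span basA.
have [||x [x0 Ax]] := common_zero _ m_ge3 n_gt0 _ basA.2 leA.
- move=> i; have [a ->] := AQ i; rewrite linear_sum /=.
  by apply: eq_bigr => j _; rewrite linearZ /= symQ.
- move=> i; have [a ->] := AQ i; rewrite linear_sum /= big1 // => j _.
  by rewrite linearZ /= trQ mulr0.
exists x; split=> // i.
(* Conversely, each Q_i is a combination of the A_j, so its form vanishes at their common zero. *)
have QA : Q i \in <<codom Q>>%VS by rewrite memv_span // codom_f.
rewrite (span_expand basA QA) qform_suml big1 // => j _.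
by rewrite qformZl Ax mulr0.
Qed.
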